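(* Let $V$ be a vertex operator algebra. Then $V$ is semilocal under either of the following two conditions: (i) $V_n = 0$ for all $n < -1$; (ii) the Jacobson radical $J(V)$ of $V$ coincides with the solvable radical $B(V)$ of $V$.
   Context: A vertex operator algebra $V$ is a (nonzero) complex vector space with vertex operators $Y(v,z)=\sum_{n\in\mathbf{Z}} v(n)z^{-n-1}$, vacuum vector $\mathbf{1}$ and conformal vector $\omega$, $Y(\omega,z)=\sum_n L(n)z^{-n-2}$, satisfying the usual axioms; $V=\bigoplus_{n\in\mathbf{Z}}V_n$ is the $L(0)$-eigenspace grading, with $\dim V_n<\infty$ and $V_n=0$ for $n$ sufficiently small. An ideal of $V$ is a subspace $I$ with $u(n)a\in I$ for all $u\in V$, $a\in I$, $n\in\mathbf{Z}$ (ideals are automatically two-sided and graded). The Jacobson radical $J(V)$ is the intersection of all maximal (proper) ideals of $V$. For an ideal $I$ and an integer $t\ge 1$, $I^t$ is the span of all states $a_1(n_1)\cdots a_{t-1}(n_{t-1})a_t$ with $a_1,\dots,a_t\in I$ and $n_1,\dots,n_{t-1}\in\mathbf{Z}$; it is an ideal. Consider the sequence of ideals starting at $I$ in which each term $K$ is followed by $K^2$, i.e. $I\supseteq I^2\supseteq (I^2)^2\supseteq\cdots$; the ideal $I$ is called solvable if some term of this sequence is $0$. The solvable radical $B(V)$ is the unique maximal solvable ideal of $V$. $V$ is called local if it has a unique maximal ideal, and semilocal if it is isomorphic to a (finite) direct sum of local vertex operator algebras (which necessarily have the same central charge as $V$). *)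

(* Defs.v *)
From HB Require Import structures.
From mathcomp Require Import all_boot all_order all_algebra.
From mathcomp Require Import boolp classical_sets reals complex.

Set Implicit Arguments.
Unset Strict Implicit.
Unset Printing Implicit Defensive.

Import Order.TTheory GRing.Theory Num.Theory.
Local Open Scope classical_set_scope.
Local Open Scope ring_scope.
Local Open Scope complex_scope.

Section Subspaces.
Variables (K : fieldType) (V : lmodType K).

Definition is_subspace (A : set V) :=
  A 0 /\ forall a u v, A u -> A v -> A (a *: u + v).

Definition span (A : set V) : set V := smallest is_subspace A.

Lemma subspace_span (A : set V) : is_subspace (span A).
Proof.
split; first by move=> B [[B0 _] _].
by move=> a u v Au Av B [sB AB]; apply: sB.2; [apply: Au|apply: Av].
Qed.

Lemma sub_span (A : set V) : A `<=` span A.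
Proof. by move=> v Av B [_]; apply. Qed.

Lemma subspace_sum (A : set V) (I : finType) (F : I -> V) :
  is_subspace A -> (forall i, A (F i)) -> A (\sum_i F i).
Proof.
move=> [A0 AP] AF; elim/big_ind: _ => // x y Ax Ay.
by rewrite -[x]scale1r; apply: AP.
Qed.

End Subspaces.

Lemma span_linear (K : fieldType) (U V : lmodType K) (f : U -> V)
    (A : set U) (B : set V) :
  linear f -> A `<=` f @^-1` B -> span A `<=` f @^-1` span B.
Proof.
move=> fL AB u; apply; split; last first.
  by move=> x Ax; apply: sub_span; exact: AB.
have [B0 BP] := subspace_span B; split.
  suff f0 : f 0 = 0 by rewrite /preimage /= f0.
  by have /eqP := fL (-1) 0 0; rewrite scaleN1r oppr0 addr0 scaleN1r addNr => /eqP.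
by move=> a x y /= Bx By; rewrite fL; apply: BP.
Qed.

(* Underlying data of a vertex operator algebra over the complex numbers R[i].
   [mode u n v] is u(n)v, so
   Y(u,z) = \sum_n u(n) z^(-n-1). *)
Record vops (R : realType) := Vops {
  vops_sort :> lmodType R[i];
  mode : vops_sort -> int -> vops_sort -> vops_sort;
  vac : vops_sort;
  conf : vops_sort }.

Arguments mode {R v}.
Arguments vac {R}.
Arguments conf {R}.

(* \omega(n+1) = L(n) as Y(\omega,z) = \sum_n L(n) z^(-n-2). *)
Definition Lop (R : realType) (V : vops R) (n : int) : V -> V :=
  mode (conf V) (n + 1).
Arguments Lop {R V}.

Definition weight_space (R : realType) (V : vops R) (n : int) : set V :=
  [set v | Lop 0 v = n%:~R *: v].
Arguments weight_space {R}.

Definition binz (F : fieldType) (m : int) (i : nat) : F :=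
  (\prod_(j < i) (m%:~R - j%:R)) / i`!%:R.
Arguments binz {F}.

(* [voa_jacobi] is the component form (Borcherds identity) of the Jacobi
   identity; by [voa_trunc] only finitely many terms are nonzero, so all large
   enough partial sums equal the full sums over i >= 0.
   In [voa_graded] directness of the sum of the V_n is automatic, these being
   eigenspaces of L(0) for distinct eigenvalues. *)
Record voa_axioms (R : realType) (c : R[i]) (V : vops R) : Prop := VoaAxioms {
  voa_nonzero : exists v : V, v <> 0;
  voa_linl : forall n (v : V), linear (fun u : V => mode u n v);
  voa_linr : forall (u : V) n, linear (mode u n);
  voa_trunc : forall u v : V, exists N : int, forall n, N <= n -> mode u n v = 0;
  voa_vacuum : forall n (v : V), mode (vac V) n v = if n == -1 then v else 0;
  voa_creation : forall u : V, mode u (-1) (vac V) = u;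
  voa_creation0 : forall (u : V) (n : int), 0 <= n -> mode u n (vac V) = 0;
  voa_jacobi : forall (u v w : V) (p q r : int),
    exists N : nat, forall M : nat, (N <= M)%N ->
      \sum_(i < M) binz p i *: mode (mode u (r + i%:Z) v) (p + q - i%:Z) w =
      \sum_(i < M) ((-1) ^+ i * binz r i) *:
         (mode u (p + r - i%:Z) (mode v (q + i%:Z) w) -
          (-1) ^ r *: mode v (q + r - i%:Z) (mode u (p + i%:Z) w));
  voa_virasoro : forall (m n : int) (v : V),
    Lop m (Lop n v) - Lop n (Lop m v) =
      (m - n)%:~R *: Lop (m + n) v +
      (if m + n == 0 then (m ^+ 3 - m)%:~R / 12%:R * c else 0) *: v;
  voa_derivative : forall (u : V) n (v : V),
    mode (Lop (-1) u) n v = - n%:~R *: mode u (n - 1) v;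
  voa_graded : span (\bigcup_n weight_space V n) = setT;
  voa_findim : forall n, exists s : seq V, weight_space V n `<=` span [set` s];
  voa_bounded : exists N : int, forall n, n < N -> weight_space V n = [set 0] }.

(* Vertex operator algebras of central charge c. *)
Record voa (R : realType) (c : R[i]) := Voa {
  voa_ops :> vops R;
  voaP : voa_axioms c voa_ops }.

Section Ideals.
Variables (R : realType) (c : R[i]) (V : voa c).
Implicit Types I K M B : set V.

Definition is_ideal I :=
  is_subspace I /\ forall (u : V) n a, I a -> I (mode u n a).

Definition maximal_ideal M :=
  [/\ is_ideal M, M <> setT &
      forall I, is_ideal I -> M `<=` I -> I = M \/ I = setT].

Definition jacobson : set V := \bigcap_(M in maximal_ideal) M.

Definition local := exists! M, maximal_ideal M.

(* The states a_1(n_1)...a_k(n_k)a_(k+1), with a_1, ..., a_(k+1) in I. *)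
Fixpoint states I (k : nat) : set V :=
  if k is k'.+1 then
    [set w | exists a n b, [/\ I a, states I k' b & w = mode a n b]]
  else I.

(* I^t; only meaningful for t >= 1. *)
Definition ideal_pow I (t : nat) : set V := span (states I t.-1).

Definition solvable I := exists k, iter k (fun K => ideal_pow K 2) I = [set 0].

Definition maximal_solvable_ideal B :=
  [/\ is_ideal B, solvable B &
      forall K, is_ideal K -> solvable K -> B `<=` K -> K = B].

(* The unique maximal solvable ideal; the default value set0 is not an ideal
   and differs from every subspace. *)
Definition solvable_radical : set V :=
  xget set0 [set B | unique maximal_solvable_ideal B].

End Ideals.

Arguments jacobson {R c}.
Arguments local {R c}.
Arguments solvable_radical {R c}.

Definition voa_iso (R : realType) (c : R[i]) (V W : voa c) :=
  exists f : V -> W,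
    [/\ linear f, bijective f,
        forall u n v, f (mode u n v) = mode (f u) n (f v),
        f (vac V) = vac W & f (conf V) = conf W].

Section DirectProductModule.
Variables (K : fieldType) (I : finType) (V : I -> lmodType K).

Definition dprod := {dffun forall i, V i}.
HB.instance Definition _ := Choice.on dprod.
Implicit Types f g h : dprod.

Definition dprod0 : dprod := [ffun i => 0 : V i].
Definition dprodN f : dprod := [ffun i => - f i : V i].
Definition dprodD f g : dprod := [ffun i => f i + g i : V i].
Definition dprodZ a f : dprod := [ffun i => a *: f i : V i].

Fact dprod_addA : associative dprodD.
Proof. by move=> f g h; apply/ffunP=> i; rewrite !ffunE addrA. Qed.
Fact dprod_addC : commutative dprodD.
Proof. by move=> f g; apply/ffunP=> i; rewrite !ffunE addrC. Qed.
Fact dprod_add0 : left_id dprod0 dprodD.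
Proof. by move=> f; apply/ffunP=> i; rewrite !ffunE add0r. Qed.
Fact dprod_addN : left_inverse dprod0 dprodN dprodD.
Proof. by move=> f; apply/ffunP=> i; rewrite !ffunE addNr. Qed.
HB.instance Definition _ := GRing.isZmodule.Build dprod
  dprod_addA dprod_addC dprod_add0 dprod_addN.

Fact dprod_scaleA a b f : dprodZ a (dprodZ b f) = dprodZ (a * b) f.
Proof. by apply/ffunP=> i; rewrite !ffunE scalerA. Qed.
Fact dprod_scale1 : left_id 1 dprodZ.
Proof. by move=> f; apply/ffunP=> i; rewrite !ffunE scale1r. Qed.
Fact dprod_scaleDr : right_distributive dprodZ +%R.
Proof. by move=> a f g; apply/ffunP=> i; rewrite !ffunE scalerDr. Qed.
Fact dprod_scaleDl f : {morph dprodZ^~ f : a b / a + b}.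
Proof. by move=> a b; apply/ffunP=> i; rewrite !ffunE scalerDl. Qed.
HB.instance Definition _ := GRing.Zmodule_isLmodule.Build K dprod
  dprod_scaleA dprod_scale1 dprod_scaleDr dprod_scaleDl.

Lemma dprod0E i : (0 : dprod) i = 0. Proof. by rewrite ffunE. Qed.
Lemma dprodNE f i : (- f) i = - f i. Proof. by rewrite ffunE. Qed.
Lemma dprodDE f g i : (f + g) i = f i + g i. Proof. by rewrite ffunE. Qed.
Lemma dprodZE a f i : (a *: f) i = a *: f i. Proof. by rewrite ffunE. Qed.
Lemma dprod_sumE (J : Type) (r : seq J) (F : J -> dprod) i :
  (\sum_(j <- r) F j) i = \sum_(j <- r) F j i.
Proof.
by apply: (big_morph (fun f : dprod => f i)) => [f g|]; rewrite ffunE.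
Qed.
Definition dprodE := (dprod0E, dprodNE, dprodDE, dprodZE, dprod_sumE).

Definition dinj i (x : V i) : dprod := [ffun j => dfwith (fun j => 0 : V j) x j].

Lemma dinj_same i (x : V i) : dinj x i = x.
Proof. by rewrite ffunE dfwith_in. Qed.

Lemma dinj_other i (x : V i) j : i != j -> dinj x j = 0.
Proof. by move=> ij; rewrite ffunE dfwith_out. Qed.

Lemma dinj_linear i : linear (@dinj i).
Proof.
move=> a x y; apply/ffunP=> j; rewrite !dprodE.
have [<-|ij] := eqVneq i j; first by rewrite !dinj_same.
by rewrite !dinj_other// scaler0 addr0.
Qed.

Lemma dprod_dinj f : f = \sum_i dinj (f i).
Proof.
apply/ffunP => j; rewrite dprod_sumE (bigD1 j)//= dinj_same big1 ?addr0// => i.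
by move=> ij; rewrite dinj_other.
Qed.

End DirectProductModule.

Section DirectSum.
Variables (R : realType) (c : R[i]) (n : nat) (W : 'I_n.+1 -> voa c).

Local Notation inj x := (dinj (V := fun i => W i : lmodType R[i]) x).

Definition dsum_ops : vops R :=
  @Vops R (dprod (fun i => W i : lmodType R[i]))
    (fun u k v => [ffun i => mode (u i) k (v i) : W i])
    [ffun i => vac (W i)] [ffun i => conf (W i)].

Lemma dsum_modeE (u v : dsum_ops) k i : mode u k v i = mode (u i) k (v i).
Proof. by rewrite ffunE. Qed.

Lemma dsum_LE k (v : dsum_ops) i : Lop k v i = Lop k (v i).
Proof. by rewrite /Lop dsum_modeE ffunE. Qed.

Lemma dsum_weight k (v : dsum_ops) :
  weight_space dsum_ops k v <-> forall i, weight_space (W i) k (v i).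
Proof.
split=> [vk i|vk]; first by move: vk => /(congr1 (fun f : dsum_ops => f i)); rewrite dsum_LE dprodE.
by apply/ffunP => i; rewrite dsum_LE dprodE; exact: vk.
Qed.

Lemma weight_dinj k i (x : W i) :
  weight_space (W i) k x ->
  weight_space dsum_ops k (inj x).
Proof.
move=> xk; apply/dsum_weight => j.
have [<-|ij] := eqVneq i j; first by rewrite dinj_same.
rewrite dinj_other// /weight_space /= scaler0 /Lop.
have /eqP := voa_linr (voaP (W j)) (conf (W j)) (0 + 1) (-1) 0 0.
by rewrite !scaleN1r oppr0 addr0 addNr => /eqP.
Qed.

Lemma fin_bound (P : 'I_n.+1 -> int -> Prop) :
  (forall i, exists N : int, forall m, N <= m -> P i m) ->
  exists N : int, forall m, N <= m -> forall i, P i m.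
Proof.
move=> /choice[N NP]; exists (\sum_i `|N i|) => m Nm i; apply: NP.
apply: le_trans Nm; rewrite (bigD1 i)//= (le_trans (ler_norm _))//.
by rewrite lerDl sumr_ge0.
Qed.

Fact dsum_axioms : voa_axioms c dsum_ops.
Proof.
split.
- have [x x0] := voa_nonzero (voaP (W ord0)).
  exists (inj x) => /(congr1 (fun f : dsum_ops => f ord0)).
  by rewrite dinj_same dprodE.
- move=> k v a u u'; apply/ffunP => i.
  by rewrite !(dsum_modeE, dprodE) (voa_linl (voaP (W i))).
- move=> u k a v v'; apply/ffunP => i.
  by rewrite !(dsum_modeE, dprodE) (voa_linr (voaP (W i))).
- move=> u v.
  have [N NP] := fin_bound (fun i => voa_trunc (voaP (W i)) (u i) (v i)).
  by exists N => m Nm; apply/ffunP => i; rewrite dsum_modeE NP// dprodE.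
- move=> k v; apply/ffunP => i.
  rewrite dsum_modeE ffunE (voa_vacuum (voaP (W i))).
  by case: ifP => //; rewrite dprodE.
- move=> u; apply/ffunP => i.
  by rewrite dsum_modeE ffunE (voa_creation (voaP (W i))).
- move=> u k k0; apply/ffunP => i.
  by rewrite dsum_modeE ffunE (voa_creation0 (voaP (W i)))// dprodE.
- move=> u v w p q r.
  have /choice[N NP] : forall i, _ :=
    fun i => voa_jacobi (voaP (W i)) (u i) (v i) (w i) p q r.
  exists (\max_i N i) => M NM; apply/ffunP => i; rewrite !dprod_sumE.
  have := NP i M (leq_trans (leq_bigmax i) NM).
  under eq_bigr do rewrite -!dsum_modeE -dprodZE.
  move=> ->; apply: eq_bigr => j _.
  by rewrite !(dsum_modeE, dprodE).
- move=> m k v; apply/ffunP => i.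
  by rewrite !(dprodE, dsum_LE) (voa_virasoro (voaP (W i))).
- move=> u k v; apply/ffunP => i.
  by rewrite !(dprodE, dsum_modeE, dsum_LE) (voa_derivative (voaP (W i))).
- rewrite -subTset => v _.
  rewrite (dprod_dinj v); apply: subspace_sum; first exact: subspace_span.
  move=> i; apply: (span_linear (@dinj_linear _ _ _ i)
    (A := \bigcup_k weight_space (W i) k)).
    by move=> x [k _ xk]; exists k => //; exact: weight_dinj.
  by rewrite (voa_graded (voaP (W i))).
- move=> k.
  pose s i := projT1 (cid (voa_findim (voaP (W i)) k)).
  have sP i : weight_space (W i) k `<=` span [set` s i] by rewrite /s; case: cid.
  exists (flatten [seq [seq inj x | x <- s i]
                  | i <- enum 'I_n.+1]) => v /dsum_weight vk.
  rewrite (dprod_dinj v); apply: subspace_sum; first exact: subspace_span.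
  move=> i; apply: (span_linear (@dinj_linear _ _ _ i) (A := [set` s i])).
    move=> x /= xs; apply/flattenP; exists [seq inj x | x <- s i].
      by apply: (map_f (fun i => [seq inj x | x <- s i])); rewrite mem_enum.
    exact: map_f.
  by apply: sP; exact: vk.
- have [|N NP] := @fin_bound (fun i m => weight_space (W i) (- m) = [set 0]).
    move=> i; have [N NP] := voa_bounded (voaP (W i)).
    by exists (1 - N) => m Nm; apply: NP; rewrite ltrNl (lt_le_trans _ Nm)// ltrDr.
  exists (- N) => m mN; apply/seteqP; split => v.
    move=> /dsum_weight vm; apply/ffunP => i; rewrite dprodE.
    have := vm i; rewrite -[m]opprK NP //.
    by rewrite lerNr ltW.
  move=> ->; apply/dsum_weight => i; rewrite dprodE -[m]opprK NP//.
  by rewrite lerNr ltW.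
Qed.

Definition direct_sum : voa c := Voa dsum_axioms.

End DirectSum.

(* Nonempty sums suffice since V is nonzero, and the summands have the central
   charge of V. *)
Definition semilocal (R : realType) (c : R[i]) (V : voa c) :=
  exists (n : nat) (W : 'I_n.+1 -> voa c),
    (forall i, local (W i)) /\ voa_iso V (direct_sum W).

(* Main.v *)
Require Import Defs.
From HB Require Import structures.
From mathcomp Require Import all_boot all_order all_algebra.
From mathcomp Require Import boolp classical_sets reals complex.
From mathcomp Require Import ring zify.

(* Write D = L(-1) and call e central if De = 0; then e(n) = 0 for n <> -1 and
   e(-1) commutes with all modes, so orthogonal central idempotents with sum 1
   split V into vertex operator algebras eV. There are at most dim V_0 maximal
   ideals M_1, ..., M_k, since the Chinese remainder theorem gives independent
   elements e_i of V_0 with e_i = delta_ij mod M_j. If the e_i can be lifted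
   modulo J(V) to central idempotents, then these are orthogonal with sum 1,
   because a central idempotent in J(V) is 0, and each block e_i V inherits
   only the maximal ideal M_i.
   Under (i), e = e_i satisfies e(n)e = 0 for n >= 0, so the powers of e span a
   finite-dimensional commutative associative algebra. It contains an
   idempotent f = e mod J(V), and Df = D(ff) = 2f(Df) forces Df = 0.
   Under (ii), the Newton step 3e^2 - 2e^3 turns an e with De and ee - e in an
   ideal K into one with both in K^2, and the sequence J, J^2, (J^2)^2, ...
   reaches 0. *)

Import Order.TTheory GRing.Theory Num.Theory.
Local Open Scope classical_set_scope.
Local Open Scope ring_scope.
Local Open Scope complex_scope.

Set Implicit Arguments.
Unset Strict Implicit.
Unset Printing Implicit Defensive.

(** * Subspaces and spans *)

Section Subspace.
Variables (K : fieldType) (U : lmodType K) (A : set U).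
Hypothesis sA : is_subspace A.

Lemma subspace0 : A 0. Proof. by case: sA. Qed.

Lemma subspaceD u v : A u -> A v -> A (u + v).
Proof. by move=> Au Av; rewrite -[u]scale1r; apply: sA.2. Qed.

Lemma subspaceZ a u : A u -> A (a *: u).
Proof. by move=> Au; rewrite -[_ *: _]addr0; apply: sA.2 => //; exact: subspace0. Qed.

Lemma subspaceN u : A u -> A (- u).
Proof. by move=> Au; rewrite -scaleN1r; apply: subspaceZ. Qed.

Lemma subspaceB u v : A u -> A v -> A (u - v).
Proof. by move=> Au Av; apply: subspaceD => //; apply: subspaceN. Qed.

Lemma subspace_congr u v : A (u - v) -> A u -> A v.
Proof. by move=> Auv Au; have := subspaceB Au Auv; rewrite opprB addrC subrK. Qed.

Lemma subspace_sum_cond (J : finType) (P : pred J) (F : J -> U) :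
  (forall i, P i -> A (F i)) -> A (\sum_(i | P i) F i).
Proof.
move=> AF; rewrite big_mkcond; apply: subspace_sum => // i.
by case: ifP => [/AF|_] //; exact: subspace0.
Qed.

End Subspace.

Lemma is_subspace_set0 (K : fieldType) (U : lmodType K) : is_subspace [set (0 : U)].
Proof. by split => // a u v /= -> ->; rewrite scaler0 addr0. Qed.

Lemma span_sub (K : fieldType) (U : lmodType K) (A B : set U) :
  is_subspace B -> A `<=` B -> Defs.span A `<=` B.
Proof. by move=> sB AB v; apply. Qed.

(** * Special values of the generalized binomial coefficients *)

Section BinomialZ.
Variable F : fieldType.

Lemma binz_n0 m : binz m 0 = 1 :> F.
Proof. by rewrite /binz big_ord0 fact0 divr1. Qed.

Lemma binz_0n i : binz 0 i = (i == 0%N)%:R :> F.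
Proof.
case: i => [|i]; first exact: binz_n0.
by rewrite /binz big_ord_recl /= subrr mul0r mul0r.
Qed.

Lemma binz_1n i : binz 1 i.+2 = 0 :> F.
Proof. by rewrite /binz !big_ord_recl /= /bump /= addn0 subrr mul0r mulr0 mul0r. Qed.

Lemma binz_11 : binz 1 1 = 1 :> F.
Proof. by rewrite /binz big_ord_recl big_ord0 subr0 divr1 mulr1. Qed.

End BinomialZ.

Lemma binz_N1n (F : numFieldType) i : binz (-1) i = (-1) ^+ i :> F.
Proof.
rewrite /binz; apply: (canLR (mulfK _)); first by rewrite pnatr_eq0 -lt0n fact_gt0.
elim: i => [|i IH]; first by rewrite big_ord0 mulr1.
rewrite big_ord_recr /= IH factS natrM -natr1 exprS mulrN1z; ring.
Qed.

(** * Bilinearity of the modes and special cases of the Borcherds identity *)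

Section Voa.
Variables (R : realType) (c : R[i]) (V : voa c).
Implicit Types (u v w a b e : V) (A B I J K M : set V) (m n p q r : int).

Local Notation D := (mode (conf V) 0).

HB.instance Definition _ u n :=
  GRing.isLinear.Build R[i] V V _ (mode u n) (voa_linr (voaP V) u n).

Lemma modeDl n u u' v : mode (u + u') n v = mode u n v + mode u' n v.
Proof. by have := voa_linl (voaP V) n v 1 u u'; rewrite !scale1r. Qed.

Lemma mode0l n v : mode 0 n v = 0.
Proof. by apply: (addrI (mode 0 n v)); rewrite -modeDl !addr0. Qed.

Lemma modeZl n x u v : mode (x *: u) n v = x *: mode u n v.
Proof. by have := voa_linl (voaP V) n v x u 0; rewrite mode0l !addr0. Qed.

Lemma modeNl n u v : mode (- u) n v = - mode u n v.
Proof. by rewrite -scaleN1r modeZl scaleN1r. Qed.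

Lemma modeBl n u u' v : mode (u - u') n v = mode u n v - mode u' n v.
Proof. by rewrite modeDl modeNl. Qed.

Lemma mode_suml n (J : Type) (s : seq J) (P : pred J) (F : J -> V) v :
  mode (\sum_(j <- s | P j) F j) n v = \sum_(j <- s | P j) mode (F j) n v.
Proof.
by apply: (big_morph (fun u => mode u n v)) => [u u'|];
  rewrite ?modeDl ?mode0l.
Qed.

Lemma modeDr u n v w : mode u n (v + w) = mode u n v + mode u n w.
Proof. exact: linearD. Qed.

Lemma modeNr u n v : mode u n (- v) = - mode u n v.
Proof. exact: linearN. Qed.

Lemma modeBr u n v w : mode u n (v - w) = mode u n v - mode u n w.
Proof. exact: linearB. Qed.

Lemma modeZr u n x v : mode u n (x *: v) = x *: mode u n v.
Proof. exact: linearZ. Qed.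

Lemma mode0r u n : mode u n 0 = 0.
Proof. exact: linear0. Qed.

Lemma LopN1 u : Lop (-1) u = D u.
Proof. by rewrite /Lop addNr. Qed.

Lemma mode_vacN1 v : mode (vac V) (-1) v = v.
Proof. by rewrite (voa_vacuum (voaP V)) eqxx. Qed.

Lemma mode_creation u : mode u (-1) (vac V) = u.
Proof. exact: (voa_creation (voaP V)). Qed.

Lemma mode_annihilation u (i : nat) : mode u i%:Z (vac V) = 0.
Proof. exact: (voa_creation0 (voaP V)). Qed.

Lemma D_vac : D (vac V) = 0.
Proof. exact: (mode_annihilation (conf V) 0). Qed.

Lemma mode_D u n v : mode (D u) n v = - n%:~R *: mode u (n - 1) v.
Proof. by rewrite -LopN1 (voa_derivative (voaP V)). Qed.

(** The Borcherds identity at r = 0: since [binz 0 i] vanishes for i > 0, the right side reduces to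
    a single commutator. *)
Lemma commutator u v w p q : exists N : nat, forall M : nat, (N <= M)%N ->
  mode u p (mode v q w) - mode v q (mode u p w) =
  \sum_(i < M) binz p i *: mode (mode u i%:Z v) (p + q - i%:Z) w.
Proof.
have [N NP] := voa_jacobi (voaP V) u v w p q 0.
(* The bound [N.+1] forces the number of terms to be a successor, so the term i = 0 can be split
   off. *)
exists N.+1 => -[//|M] NM; have := NP M.+1 (ltnW NM).
under eq_bigr do rewrite add0r.
move=> ->; rewrite big_ord_recl big1 ?addr0 /= => [|i _].
  by rewrite binz_n0 expr0z mulr1 !scale1r.
by rewrite binz_0n mulr0 scale0r.
Qed.

(** The Borcherds identity at p = 0, where the left side reduces to its term i = 0. *)
Lemma associator u v w r q : exists N : nat, forall M : nat, (N <= M)%N ->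
  mode (mode u r v) q w =
  \sum_(i < M) ((-1) ^+ i * binz r i) *:
    (mode u (r - i%:Z) (mode v (q + i%:Z) w) -
     (-1) ^ r *: mode v (q + r - i%:Z) (mode u i%:Z w)).
Proof.
have [N NP] := voa_jacobi (voaP V) u v w 0 q r.
exists N.+1 => -[//|M] NM; have := NP M.+1 (ltnW NM).
rewrite big_ord_recl big1 ?addr0 /= => [|i _]; last by rewrite binz_0n scale0r.
rewrite binz_n0 scale1r add0r => ->.
by under eq_bigr do rewrite !add0r.
Qed.

(** The Borcherds identity applied to the vacuum with p = -1 and q = 0: the creation axioms leave
    only the term i = 0 on the right, a multiple of v(r)u. Since a(-1-i) sends the vacuum to D^i a /
    i!, this is the usual skew symmetry. *)
Lemma skew_symmetry u v r : exists N : nat, forall M : nat, (N <= M)%N ->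
  mode v r u = - (-1) ^ r *:
  \sum_(i < M) (-1) ^+ i *: mode (mode u (r + i%:Z) v) (-1 - i%:Z) (vac V).
Proof.
have [N NP] := voa_jacobi (voaP V) u v (vac V) (-1) 0 r.
exists N.+1 => -[//|M] NM; have := NP M.+1 (ltnW NM).
under eq_bigr do rewrite binz_N1n addr0.
move=> ->; rewrite big_ord_recl big1 ?addr0 /= => [|i _].
  rewrite binz_n0 mulr1 scale1r (mode_annihilation v 0) mode0r sub0r.
  rewrite mode_creation add0r scalerN scaleNr opprK scalerA.
  rewrite -exprMz_comm ?rpredN1 ?unitrN1 //.
  by rewrite mulrNN mulr1 exp1rz scale1r.
rewrite add0r mode_annihilation mode0r.
rewrite (_ : -1 + (bump 0 i)%:Z = i%:Z); last by rewrite /bump /=; lia.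
by rewrite mode_annihilation mode0r scaler0 subr0 scaler0.
Qed.

End Voa.

(** * Ideals, maximal ideals and the Chinese remainder theorem *)

Section Ideals.
Variables (R : realType) (c : R[i]) (V : voa c).
Implicit Types (u v w a b e : V) (I M : set V) (m n p q r : int).

Local Notation D := (mode (conf V) 0).

(** The state is D^i a / i!. The induction applies the hypothesis to Da and divides by the nonzero
    scalar 1 + i coming from [mode_D]. *)
Lemma ideal_descend I a (i : nat) :
  is_ideal I -> I a -> I (mode a (-1 - i%:Z) (vac V)).
Proof.
move=> iI; elim: i a => [|i IH] a Ia; first by rewrite subr0 mode_creation.
have := IH _ (iI.2 (conf V) 0 a Ia); rewrite mode_D.
rewrite (_ : -1 - i%:Z - 1 = -1 - i.+1%:Z); last by lia.
move=> /(subspaceZ iI.1 (- (-1 - i%:Z)%:~R)^-1); rewrite scalerA mulVf ?scale1r //.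
by rewrite oppr_eq0 intr_eq0; lia.
Qed.

(** Skew symmetry writes a(n)v through the states v(j)a of I and their derivatives, so left ideals
    are two-sided. *)
Lemma ideal_right I a n v : is_ideal I -> I a -> I (mode a n v).
Proof.
move=> iI Ia; have [N /(_ N (leqnn N)) ->] := skew_symmetry v a n.
apply: subspaceZ iI.1 _ _ _; apply: subspace_sum iI.1 _ => i.
by apply: subspaceZ iI.1 _ _ _; apply: ideal_descend => //; apply: iI.2.
Qed.

Lemma ideal_vac I : is_ideal I -> I (vac V) -> I = setT.
Proof.
move=> iI I1; apply/seteqP; split => // v _.
by rewrite -(mode_creation v); apply: iI.2.
Qed.

Lemma maximal_ideal_vac M : maximal_ideal M -> ~ M (vac V).
Proof. by move=> [iM MT _] /(ideal_vac iM). Qed.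

(** An ideal is proper exactly when it misses the vacuum, a condition stable under unions of chains,
    so Zorn's lemma applies. *)
Lemma sub_maximal_ideal I :
  is_ideal I -> ~ I (vac V) -> exists2 M, maximal_ideal M & I `<=` M.
Proof.
move=> iI I1.
pose P := [set A | A = set0 \/ [/\ is_ideal A, I `<=` A & ~ A (vac V)]].
have [|A [PA maxA]] := @Zorn_bigcup V P.
  move=> F FP Ftot.
  have [[A0 FA0 [x0 A0x0]]|F0] := pselect (exists2 A, F A & A !=set0); last first.
    left; apply/seteqP; split => // x [A FA Ax].
    by case: F0; exists A => //; exists x.
  right.
  have F3 A x : F A -> A x -> [/\ is_ideal A, I `<=` A & ~ A (vac V)].
    by move=> /FP[->|].
  have [iA0 IA0 _] := F3 _ _ FA0 A0x0.
  split; first split; first split.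
  - by exists A0 => //; apply: subspace0 iA0.1.
  - move=> x u v [A FA Au] [B FB Bv].
    have [iA _ _] := F3 _ _ FA Au; have [iB _ _] := F3 _ _ FB Bv.
    have [AB|BA] := Ftot _ _ FA FB.
      by exists B => //; apply: iB.1.2 => //; apply: AB.
    by exists A => //; apply: iA.1.2 => //; apply: BA.
  - move=> u n a [A FA Aa]; exists A => //.
    by have [iA _ _] := F3 _ _ FA Aa; apply: iA.2.
  - by move=> x Ix; exists A0 => //; apply: IA0.
  - by move=> [A FA A1]; have [_ _] := F3 _ _ FA A1.
have [A0|[iA IA A1]] := PA.
  exfalso; apply: (maxA I); last by right; split.
  rewrite A0; split; first exact: sub0set.
  by move=> /(_ 0 (subspace0 iI.1)).
exists A => //; split => //; first by move=> AT; apply: A1; rewrite AT.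
move=> B iB AB; have [B1|B1] := pselect (B (vac V)).
  by right; apply: ideal_vac.
left; apply: contrapT => BA; apply: (maxA B).
  by split => // BA'; apply: BA; apply/seteqP.
by right; split => // x /IA /AB.
Qed.

Lemma ideal_jacobson : is_ideal (jacobson V).
Proof.
split; first split.
- by move=> M [iM _ _]; apply: subspace0 iM.1.
- by move=> x u v Ju Jv M mM; have [iM _ _] := mM; apply: iM.1.2; [apply: Ju|apply: Jv].
- by move=> u n a Ja M mM; have [iM _ _] := mM; apply: iM.2; apply: Ja.
Qed.

Lemma maximal_comaximal M I :
  maximal_ideal M -> is_ideal I -> ~ I `<=` M ->
  exists2 a, I a & M (a - vac V).
Proof.
move=> [iM MT maxM] iI IM.
(* [S] is the ideal I + M. *)
pose S := [set v | exists a, I a /\ M (a - v)].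
have [||SM|ST] := maxM S.
- split; first split.
  + by exists 0; split; [apply: subspace0 iI.1|rewrite subr0; apply: subspace0 iM.1].
  + move=> x u v [a [Ia Ma]] [b [Ib Mb]]; exists (x *: a + b); split.
      exact: iI.1.2.
    rewrite opprD addrACA -scalerBr; exact: iM.1.2.
  + move=> u n v [a [Ia Ma]]; exists (mode u n a); split; first exact: iI.2.
    by rewrite -modeBr; apply: iM.2.
- move=> v Mv; exists 0; split; first exact: subspace0 iI.1.
  by rewrite sub0r; apply: subspaceN iM.1 _ _.
- case: IM; rewrite -SM => a Ia; exists a; split => //.
  by rewrite subrr; apply: subspace0 iM.1.
- have [a [Ia Ma]] : S (vac V) by rewrite ST.
  by exists a.
Qed.

Lemma maximal_ideal_sub M M' :
  maximal_ideal M -> maximal_ideal M' -> M `<=` M' -> M = M'.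
Proof. by move=> [_ _ maxM] [iM' M'T _] /(maxM _ iM') [->|]. Qed.

Lemma maximal_ideal_crt k (M : 'I_k -> set V) :
  (forall i, maximal_ideal (M i)) -> injective M ->
  exists e : 'I_k -> V, forall i j, M j (e i - (i == j)%:R *: vac V).
Proof.
move=> mM Minj.
suff H i : exists e, forall j, M j (e - (i == j)%:R *: vac V).
  by have [e eP] := choice H; exists e.
(* The element for i is a product of elements of the other M_j, each congruent to the vacuum modulo
   M_i; it is built one factor at a time along [s]. *)
suff H (s : seq 'I_k) : i \notin s ->
    exists e, M i (e - vac V) /\ forall j, j \in s -> M j e.
  have [|e [Mie Mje]] := H (rem i (enum 'I_k)).
    by rewrite mem_rem_uniqF ?enum_uniq.
  exists e => j; have [<-|ij] := eqVneq i j; first by rewrite scale1r.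
  rewrite scale0r subr0; apply: Mje.
  by rewrite mem_rem_uniq ?enum_uniq // inE eq_sym ij mem_enum.
have [iMi _ _] := mM i.
elim: s => [_|j s IH].
  exists (vac V); split => //; rewrite subrr; exact: subspace0 iMi.1.
rewrite inE negb_or => /andP[ij /IH [e [Mie Mse]]].
have [iMj _ _] := mM j.
have [|a Mja Mia] := maximal_comaximal (mM i) iMj.
  by move=> /(maximal_ideal_sub (mM j) (mM i)) /Minj ji; rewrite ji eqxx in ij.
exists (mode a (-1) e); split.
  have -> : mode a (-1) e - vac V = mode (a - vac V) (-1) e + (e - vac V).
    by rewrite modeBl mode_vacN1 addrA subrK.
  by apply: subspaceD iMi.1 _ _ _ _ => //; apply: ideal_right.
move=> j'; rewrite inE => /orP[/eqP ->|j's]; first exact: ideal_right.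
by have [iM' _ _] := mM j'; apply: iM'.2; apply: Mse.
Qed.

End Ideals.

(** * Linear dependence in the span of a finite list *)

Lemma span_seqP (K : fieldType) (U : lmodType K) (s : seq U) v :
  Defs.span [set` s] v -> exists a : 'I_(size s) -> K, v = \sum_j a j *: s`_j.
Proof.
pose B := [set v | exists a : 'I_(size s) -> K, v = \sum_j a j *: s`_j].
apply: (@span_sub _ _ _ B); first split.
- by exists (fun=> 0); rewrite big1 // => j _; rewrite scale0r.
- move=> x _ _ [a ->] [b ->]; exists (fun j => x * a j + b j).
  rewrite scaler_sumr -big_split /=; apply: eq_bigr => j _.
  by rewrite scalerA -scalerDl.
- move=> u /= us; have us' := us; rewrite -index_mem in us'.
  exists (fun j => (j == Ordinal us')%:R).
  rewrite (bigD1 (Ordinal us')) //= eqxx scale1r nth_index // big1 ?addr0 // => j.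
  by move=> /negPf ->; rewrite scale0r.
Qed.

(** The coordinate matrix has more rows than columns, so its left kernel contains a nonzero row,
    which gives the coefficients. *)
Lemma span_dependent (K : fieldType) (U : lmodType K) (s : seq U) k
    (e : 'I_k -> U) :
  (forall i, Defs.span [set` s] (e i)) -> (size s < k)%N ->
  exists a : 'I_k -> K, (exists i, a i != 0) /\ \sum_i a i *: e i = 0.
Proof.
move=> es sk.
have [A AP] := choice (fun i => span_seqP (es i)).
pose B := \matrix_(i, j) A i j.
have : kermx B != 0.
  rewrite kermx_eq0; apply: contraL sk => /eqP Bfree; rewrite -leqNgt.
  by rewrite -[X in (X <= _)%N]Bfree rank_leq_col.
move=> /rowV0Pn [x /sub_kermxP xB x0]; exists (x 0); split.
  apply/existsP; apply: contraNT x0 => /existsPn x0.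
  by apply/eqP/rowP => i; rewrite mxE; apply/eqP; have := x0 i; rewrite negbK.
under eq_bigr do rewrite AP scaler_sumr.
rewrite exchange_big big1 //= => j _.
under eq_bigr do rewrite scalerA; rewrite -scaler_suml.
have /rowP /(_ j) := xB; rewrite !mxE => xBj.
rewrite (_ : \sum_i _ = 0) ?scale0r // -[RHS]xBj.
by apply: eq_bigr => i _; rewrite mxE.
Qed.

(** * Weight-zero parts and finiteness of the set of maximal ideals *)

Section Weights.
Variables (R : realType) (c : R[i]) (V : voa c).
Implicit Types (u v w a b e : V) (I M : set V) (m n p q r : int).

Local Notation D := (mode (conf V) 0).
Local Notation L0 := (mode (conf V) 1).

Lemma weight_spaceE n v : weight_space V n v = (L0 v = n%:~R *: v).
Proof. by rewrite /weight_space /Lop /= add0r. Qed.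

Lemma weight_vac : weight_space V 0 (vac V).
Proof. by rewrite weight_spaceE scale0r (mode_annihilation _ 1). Qed.

(** The commutator formula for the conformal vector with p = 1 has only the terms i = 0 and i = 1,
    and (Dv)(q+1) = -(q+1)v(q). *)
Lemma L0_mode v q w :
  L0 (mode v q w) = mode v q (L0 w) + mode (L0 v) q w - (q + 1)%:~R *: mode v q w.
Proof.
have [N NP] := commutator (conf V) v w 1 q.
have /eqP := NP N.+2 (leqW (leqnSn N)); rewrite subr_eq => /eqP ->.
rewrite !big_ord_recl big1 /= => [|i _]; last by rewrite binz_1n scale0r.
rewrite binz_n0 binz_11 !scale1r addr0 mode_D /bump /=.
rewrite (_ : 1 + q - 1 = q); last by lia.
rewrite (_ : 1 + q = q + 1); last by lia.
by rewrite scaleNr addrC addrA addr0 addrAC.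
Qed.

Lemma weight_mode m n k u v : weight_space V m u -> weight_space V n v ->
  weight_space V (m + n - k - 1) (mode u k v).
Proof.
rewrite !weight_spaceE => mu nv.
rewrite L0_mode mu nv modeZr modeZl -!scalerDl -scalerBl -!intrD -intrB.
by congr (_%:~R *: _); lia.
Qed.

(** The product of the operators 1 - L(0)/n over n in [s]: it fixes V_0 and kills V_n for each
    nonzero n in [s]. Being a polynomial in L(0), it maps every ideal to itself, which isolates a
    weight-zero part without first proving that ideals are graded. For n = 0 the convention 0^-1 = 0
    makes the factor the identity. *)
Definition kill_weights (s : seq int) v : V :=
  foldr (fun n u => u - n%:~R^-1 *: L0 u) v s.

Lemma kill_weights_linear s : linear (kill_weights s).
Proof.
move=> x u v; elim: s => //= n s ->.
rewrite modeDr modeZr !scalerDr !opprD !addrA [x *: _ + _ - _]addrAC.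
by congr (_ + _ - _); rewrite scalerN !scalerA mulrC.
Qed.

Lemma kill_weights_id s v : weight_space V 0 v -> kill_weights s v = v.
Proof.
rewrite weight_spaceE scale0r => v0.
by elim: s => //= n s ->; rewrite v0 scaler0 subr0.
Qed.

Lemma kill_weights_L0 s v : kill_weights s (L0 v) = L0 (kill_weights s v).
Proof. by elim: s => //= n s ->; rewrite modeBr modeZr. Qed.

Lemma kill_weightsC s t v :
  kill_weights s (kill_weights t v) = kill_weights t (kill_weights s v).
Proof.
elim: t => //= n t <-; rewrite addrC -scaleNr kill_weights_linear.
by rewrite kill_weights_L0 addrC scaleNr.
Qed.

Lemma kill_weights_ideal s I v : is_ideal I -> I v -> I (kill_weights s v).
Proof.
move=> iI Iv; elim: s => //= n s IH; apply: (subspaceB iI.1 IH).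
by apply: (subspaceZ iI.1); apply: iI.2.
Qed.

(** Lists that work for two vectors can be concatenated: the operators commute and fix whatever
    already has weight 0. *)
Lemma kill_weightsP v : exists s, weight_space V 0 (kill_weights s v).
Proof.
have : Defs.span (\bigcup_n weight_space V n) v by rewrite (voa_graded (voaP V)).
pose B := [set v | exists s, weight_space V 0 (kill_weights s v)].
apply: (@span_sub _ _ _ B); first split.
- by exists [::]; rewrite weight_spaceE /= mode0r scaler0.
- move=> x u w [s us] [t wt]; exists (s ++ t).
  rewrite /kill_weights foldr_cat -!/(kill_weights _ _) !kill_weights_linear.
  rewrite kill_weightsC (kill_weights_id t us) (kill_weights_id s wt).
  move: us wt; rewrite !weight_spaceE modeDr modeZr => -> ->.
  by rewrite !scale0r scaler0 addr0.
- move=> u [n _]; rewrite weight_spaceE => un.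
  have [n0|n0] := eqVneq n 0.
    by exists [::]; rewrite /= weight_spaceE un n0.
  exists [:: n] => /=.
  rewrite un scalerA mulVf ?intr_eq0 // scale1r subrr weight_spaceE.
  by rewrite mode0r scaler0.
Qed.

(** The operator producing [v0] preserves ideals and fixes the vacuum, hence keeps congruences to
    multiples of the vacuum. *)
Lemma weight0_part v : exists2 v0, weight_space V 0 v0 &
  forall I x, is_ideal I -> I (v - x *: vac V) -> I (v0 - x *: vac V).
Proof.
have [s sv] := kill_weightsP v; exists (kill_weights s v) => // I x iI.
move=> /(kill_weights_ideal s iI); rewrite addrC -scaleNr kill_weights_linear.
by rewrite (kill_weights_id s weight_vac) addrC scaleNr.
Qed.

Lemma maximal_ideal_crt0 k (M : 'I_k -> set V) :
  (forall i, maximal_ideal (M i)) -> injective M ->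
  exists e : 'I_k -> V, (forall i, weight_space V 0 (e i)) /\
    forall i j, M j (e i - (i == j)%:R *: vac V).
Proof.
move=> mM Minj; have [e eM] := maximal_ideal_crt mM Minj.
have /choice[f fP] i : exists v0, weight_space V 0 v0 /\
    forall j, M j (v0 - (i == j)%:R *: vac V).
  have [v0 v00 v0I] := weight0_part (e i); exists v0; split => // j.
  by have [iMj _ _] := mM j; apply: v0I.
by exists f; split => [i|i j]; [apply: (fP i).1|apply: (fP i).2].
Qed.

(** Elements e_i of V_0 with e_i = delta_ij mod M_j are independent, as reducing a relation modulo
    M_j isolates its j-th coefficient; so their number is at most that of the generators of V_0. *)
Lemma maximal_ideals_bounded : exists N, forall k (M : 'I_k -> set V),
  (forall i, maximal_ideal (M i)) -> injective M -> (k <= N)%N.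
Proof.
have [s sP] := voa_findim (voaP V) 0.
exists (size s) => k M mM Minj; rewrite leqNgt; apply/negP => sk.
have [e [e0 eM]] := maximal_ideal_crt0 mM Minj.
have [a [[j aj0] ae0]] := span_dependent (fun i => sP _ (e0 i)) sk.
have [iMj _ _] := mM j; apply: (maximal_ideal_vac (mM j)).
suff : M j (- a j *: vac V).
  move=> /(subspaceZ iMj.1 (- a j)^-1).
  by rewrite scalerA mulVf ?oppr_eq0 // scale1r.
have -> : - a j *: vac V = \sum_i a i *: (e i - (i == j)%:R *: vac V).
  under eq_bigr do rewrite scalerBr scalerA.
  rewrite sumrB ae0 sub0r (bigD1 j) //= eqxx mulr1 big1 ?addr0 ?scaleNr // => i.
  by move=> /negPf ->; rewrite mulr0 scale0r.
by apply: subspace_sum iMj.1 _ => i; apply: subspaceZ iMj.1 _ _ _.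
Qed.

(** An injective family of largest possible size is complete, since a missing maximal ideal could be
    put in front of it. *)
Lemma maximal_ideals_enum : exists k (M : 'I_k -> set V),
  [/\ forall i, maximal_ideal (M i), injective M &
      forall M', maximal_ideal M' -> exists i, M' = M i].
Proof.
have [N NP] := maximal_ideals_bounded.
pose P k := `[< exists M : 'I_k -> set V,
  (forall i, maximal_ideal (M i)) /\ injective M >].
have P0 : exists k, P k.
  exists 0%N; apply/asboolP.
  by exists (fun=> setT); split=> [[//]|[//]].
have PN k : P k -> (k <= N)%N by move=> /asboolP [M [mM Minj]]; apply: NP Minj.
case: (ex_maxnP P0 PN) => k /asboolP [M [mM Minj]] maxk.
exists k, M; split => // M' mM'; apply: contrapT => M'M.
suff : P k.+1 by move=> /maxk; rewrite ltnn.
apply/asboolP; exists (fun i => oapp M M' (unlift ord0 i)); split.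
  by move=> i; case: unliftP => [j|] _ /=.
move=> i j; case: (unliftP ord0 i) => [i' ->|->];
  case: (unliftP ord0 j) => [j' ->|->] //=.
- by move=> /Minj ->.
- by move=> MM'; case: M'M; exists i'.
- by move=> MM'; case: M'M; exists j'.
Qed.

End Weights.

(** * Central elements and central idempotents *)

Section Central.
Variables (R : realType) (c : R[i]) (V : voa c).
Implicit Types (u v w a b e f : V) (I M : set V) (m n p q r : int).

Local Notation D := (mode (conf V) 0).

Lemma mode_comm u v p q w : (forall i : nat, mode u i%:Z v = 0) ->
  mode u p (mode v q w) = mode v q (mode u p w).
Proof.
move=> uv; have [N /(_ N (leqnn N))/eqP] := commutator u v w p q.
rewrite big1 ?subr_eq0 => [/eqP //|i _].
by rewrite uv mode0l scaler0.
Qed.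

Lemma D_mode u n v : D (mode u n v) = mode (D u) n v + mode u n (D v).
Proof.
have [N NP] := commutator (conf V) u v 0 n.
have /eqP := NP N.+1 (leqnSn N); rewrite subr_eq => /eqP ->.
rewrite big_ord_recl big1 ?addr0 /= => [|i _]; last by rewrite binz_0n scale0r.
by rewrite binz_n0 scale1r add0r.
Qed.

Lemma associatorN1 u v w q : exists N : nat, forall M : nat, (N <= M)%N ->
  mode (mode u (-1) v) q w =
  \sum_(i < M) (mode u (-1 - i%:Z) (mode v (q + i%:Z) w) +
                mode v (q - 1 - i%:Z) (mode u i%:Z w)).
Proof.
have [N NP] := associator u v w (-1) q; exists N => M /NP ->.
apply: eq_bigr => i _; rewrite binz_N1n -exprMn mulrNN mulr1 expr1n scale1r.
by rewrite exprN1 invrN1 scaleN1r opprK.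
Qed.

(** In the associator formula each term other than u(-1)v(-1)w contains u(i)w or v(i)w with i >=
    0. *)
Lemma mode_assoc u v w :
  (forall i : nat, mode u i%:Z w = 0) -> (forall i : nat, mode v i%:Z w = 0) ->
  mode (mode u (-1) v) (-1) w = mode u (-1) (mode v (-1) w).
Proof.
move=> uw vw; have [N NP] := associatorN1 u v w (-1).
rewrite (NP N.+1 (leqnSn N)) big_ord_recl big1 /= => [|i _].
  by rewrite (uw 0%N) mode0r !addr0.
rewrite uw mode0r (_ : -1 + (bump 0 i)%:Z = i%:Z); last by rewrite /bump /=; lia.
by rewrite vw mode0r addr0.
Qed.

Lemma central_mode e n v : D e = 0 -> n != -1 -> mode e n v = 0.
Proof.
move=> De n1; have := mode_D e (n + 1) v.
rewrite De mode0l addrK => /esym/eqP; rewrite scaler_eq0 oppr_eq0 intr_eq0.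
by rewrite addr_eq0 (negPf n1) => /eqP.
Qed.

Lemma central_comm e u q w :
  D e = 0 -> mode e (-1) (mode u q w) = mode u q (mode e (-1) w).
Proof. by move=> De; apply: mode_comm => i; apply: central_mode. Qed.

(** Every mode e(n) with n <> -1 vanishes, so the associator formula keeps only its first term at i
    = 0. *)
Lemma central_assoc e u q w :
  D e = 0 -> mode (mode e (-1) u) q w = mode e (-1) (mode u q w).
Proof.
move=> De; have [N NP] := associatorN1 e u w q.
rewrite (NP N.+1 (leqnSn N)) big_ord_recl big1 /= => [|i _].
  by rewrite (@central_mode e 0) // mode0r !addr0.
by rewrite (@central_mode e _ w) // mode0r addr0 central_mode.
Qed.

Lemma central_right e v : D e = 0 -> mode v (-1) e = mode e (-1) v.
Proof.
by move=> De; rewrite -[in LHS](mode_creation e) -central_comm // mode_creation.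
Qed.

Lemma central_mul e f : D e = 0 -> D f = 0 -> D (mode e (-1) f) = 0.
Proof. by move=> De Df; rewrite D_mode De Df mode0l mode0r addr0. Qed.

(** The annihilator of e is an ideal containing 1 - e. If it were proper, a maximal ideal above it
    would contain both 1 - e and e, hence the vacuum; so it contains the vacuum, and e = 0. *)
Lemma central_idempotent_jacobson e :
  D e = 0 -> mode e (-1) e = e -> jacobson V e -> e = 0.
Proof.
move=> De ee Je; pose I := [set v | mode e (-1) v = 0].
have iI : is_ideal I.
  split; first split; rewrite /I /=.
  - exact: mode0r.
  - by move=> x u v /= eu ev; rewrite modeDr modeZr eu ev scaler0 addr0.
  - by move=> u n a /= ea; rewrite central_comm // ea mode0r.
have [I1|I1] := pselect (I (vac V)); first by rewrite -(mode_creation e).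
have [M mM IM] := sub_maximal_ideal iI I1.
have [iM _ _] := mM; case: (maximal_ideal_vac mM).
apply: (subspace_congr iM.1 _ (Je M mM)); apply: IM.
by rewrite /I /= modeBr ee mode_creation subrr.
Qed.

Lemma vac_neq0 : vac V <> 0.
Proof.
have [v v0] := voa_nonzero (voaP V); move=> V0; apply: v0.
by rewrite -(mode_creation v) V0 mode0r.
Qed.

Lemma maximal_ideal_ex : exists M, @maximal_ideal R c V M.
Proof.
have [||M mM _] := @sub_maximal_ideal R c V [set 0]; last by exists M.
  by split; [exact: is_subspace_set0|move=> u n a ->; exact: mode0r].
exact: vac_neq0.
Qed.

(** Nonzero, because the block eV has to be a nonzero space. *)
Record central_idempotent := CentralIdempotent {
  cidem :> V;
  cidem_central : D cidem = 0;
  cidemM : mode cidem (-1) cidem = cidem;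
  cidem_neq0 : cidem <> 0 }.

End Central.

(** * The vertex operator algebra eV of a central idempotent e, and direct sums of blocks *)

Section Block.
Variables (R : realType) (c : R[i]) (V : voa c) (e : central_idempotent V).

Local Notation D := (mode (conf V) 0).
Local Notation act := (mode e (-1)).

Let De : D e = 0. Proof. exact: cidem_central. Qed.

(** The image eV of the projection e(-1), given as its fixed points so that membership is a boolean
    equation. *)
Definition block_pred : {pred V} := [pred v | act v == v].

Fact block_submod_closed : submod_closed block_pred.
Proof.
split; first by rewrite inE mode0r.
by move=> x u v; rewrite !inE modeDr modeZr => /eqP -> /eqP ->.
Qed.
HB.instance Definition _ :=
  GRing.isSubmodClosed.Build R[i] V block_pred block_submod_closed.

Record block := Block { block_val :> V; block_valP : block_val \in block_pred }.
HB.instance Definition _ := [isSub for block_val].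
HB.instance Definition _ := [Choice of block by <:].
HB.instance Definition _ := [SubChoice_isSubLmodule of block by <:].

Lemma block_act (v : block) : act v = v.
Proof. exact/eqP/(block_valP v). Qed.

Fact block_mode_subproof (u v : block) n : mode (u : V) n v \in block_pred.
Proof. by rewrite inE central_comm // block_act. Qed.

Fact block_proj_subproof v : act v \in block_pred.
Proof. by rewrite inE -central_assoc // cidemM. Qed.

Definition block_proj (v : V) : block := Block (block_proj_subproof v).

Definition block_ops : vops R :=
  @Vops R block (fun u n v => Block (block_mode_subproof u v n))
    (block_proj (vac V)) (block_proj (conf V)).

Lemma block_proj_linear : linear (block_proj : V -> block).
Proof. by move=> x u v; apply: val_inj; rewrite /= modeDr modeZr. Qed.

(** On eV the modes of e(-1)omega act as those of omega. Hence weights, Virasoro relations and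
    central charge are inherited from V. *)
Lemma block_val_Lop n (v : block_ops) : val (Lop n v) = Lop n (val v).
Proof. by rewrite /Lop /= central_assoc // central_comm // block_act. Qed.

Lemma block_valD (u v : block) : val (u + v) = val u + val v.
Proof. exact: raddfD. Qed.

Lemma block_valB (u v : block) : val (u - v) = val u - val v.
Proof. exact: raddfB. Qed.

Lemma block_valZ x (v : block) : val (x *: v) = x *: val v.
Proof. exact: linearZ. Qed.

Lemma block_val_sum (J : Type) (s : seq J) (F : J -> block) :
  val (\sum_(j <- s) F j) = \sum_(j <- s) val (F j).
Proof. by apply: (big_morph val) => [u v|]; [exact: block_valD|exact: raddf0]. Qed.

Lemma block_weight n (v : block_ops) :
  weight_space block_ops n v <-> weight_space V n (val v).
Proof.
split => [/(congr1 val)|vn]; first by rewrite block_val_Lop.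
by apply: val_inj; rewrite block_val_Lop.
Qed.

Lemma block_proj_weight n v :
  weight_space V n v -> weight_space block_ops n (block_proj v).
Proof.
move=> vn; apply/block_weight => /=.
by move: vn; rewrite !weight_spaceE -central_comm // => ->; rewrite modeZr.
Qed.

Lemma block_projK (v : block) : block_proj (val v) = v.
Proof. by apply: val_inj; exact: block_act. Qed.

Fact block_axioms : voa_axioms c block_ops.
Proof.
split.
- exists (block_proj (vac V)) => /(congr1 val) /=.
  by rewrite mode_creation; exact: cidem_neq0.
- by move=> n v x u u'; apply: val_inj; rewrite /= modeDl modeZl.
- by move=> u n x v v'; apply: val_inj; rewrite /= modeDr modeZr.
- move=> u v; have [N NP] := voa_trunc (voaP V) (val u) (val v).
  by exists N => n Nn; apply: val_inj; rewrite /= NP.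
- move=> n v; apply: val_inj; rewrite /= mode_creation.
  have [->|n1] := eqVneq n (-1); first exact: block_act.
  by rewrite central_mode.
- move=> u; apply: val_inj => /=.
  by rewrite mode_creation central_right // block_act.
- move=> u n n0; apply: val_inj => /=.
  by rewrite -central_comm // (voa_creation0 (voaP V)) // mode0r.
- move=> u v w p q r.
  have [N NP] := voa_jacobi (voaP V) (val u) (val v) (val w) p q r.
  by exists N => M NM; apply: val_inj; rewrite !block_val_sum; exact: NP.
- move=> m n v; apply: val_inj.
  rewrite block_valB block_valD !block_valZ !block_val_Lop.
  exact: (voa_virasoro (voaP V)).
- move=> u n v; apply: val_inj; rewrite -[LHS]/(mode (val (Lop (-1) u)) n (val v)) block_val_Lop.
  exact: (voa_derivative (voaP V)).
- rewrite -subTset => v _; rewrite -[v]block_projK.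
  apply: (span_linear block_proj_linear
    (A := \bigcup_k weight_space V k)).
    by move=> x [k _ xk]; exists k => //; exact: block_proj_weight.
  by rewrite (voa_graded (voaP V)).
- move=> n; have [s sP] := voa_findim (voaP V) n.
  exists [seq block_proj x | x <- s] => v /block_weight vn.
  rewrite -[v]block_projK.
  apply: (span_linear block_proj_linear (A := [set` s])); last exact: sP.
  by move=> x /= xs; apply: map_f.
- have [N NP] := voa_bounded (voaP V); exists N => n nN.
  apply/seteqP; split => v.
    by move=> /block_weight; rewrite NP // => v0; apply: val_inj.
  by move=> ->; apply/block_weight; rewrite NP.
Qed.

Definition block_voa : voa c := Voa block_axioms.

(** Centrality moves both factors e to the front of the right side, and idempotency merges them. So
    v -> ev respects all modes and pulls ideals back to ideals. *)
Lemma block_proj_mode u n v :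
  block_proj (mode u n v) = mode (block_proj u : block_voa) n (block_proj v).
Proof.
apply: val_inj => /=.
by rewrite [RHS]central_assoc // -(central_comm u n v De) -[RHS]central_assoc // cidemM.
Qed.

Lemma block_ideal_preimage (I : set block_voa) :
  is_ideal I -> is_ideal (block_proj @^-1` I : set V).
Proof.
move=> iI; split; first split; rewrite /preimage /=.
- suff -> : block_proj 0 = 0 by apply: subspace0 iI.1.
  by apply: val_inj; rewrite /= mode0r.
- by move=> x u v /= Iu Iv; rewrite block_proj_linear; apply: iI.1.2.
- by move=> u n a /= Ia; rewrite block_proj_mode; apply: iI.2.
Qed.

Lemma block_ideal_val (I : set V) :
  is_ideal I -> is_ideal ([set v | I (val v)] : set block_voa).
Proof.
move=> iI; split; first split; rewrite /=.
- exact: subspace0 iI.1.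
- by move=> x u v /= Iu Iv; apply: iI.1.2.
- by move=> u n a /= Ia; apply: iI.2.
Qed.

(** Let I be an ideal above the preimage of M. Its trace on eV is M or eV. In the first case I is
    the preimage; in the second I contains e, and it contains 1 - e, which projects to 0, so I =
    V. *)
Lemma block_maximal_ideal (M : set block_voa) :
  maximal_ideal M -> maximal_ideal (block_proj @^-1` M : set V).
Proof.
move=> mM; have [iM MT maxM] := mM.
split; first exact: block_ideal_preimage.
  move=> MT'; apply: (maximal_ideal_vac mM).
  by have : (block_proj @^-1` M) (vac V) by rewrite MT'.
move=> I iI MI.
have MIv : M `<=` [set v | I (val v)].
  by move=> v Mv; apply: MI; rewrite /preimage /= block_projK.
have [IM|IT] := maxM _ (block_ideal_val iI) MIv.
  left; apply/seteqP; split => // v Iv; rewrite /preimage /= -IM /=.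
  exact: iI.2.
right; apply: ideal_vac => //.
have Ie : I e.
  have : [set v : block_voa | I (val v)] (vac block_voa) by rewrite IT.
  by rewrite /= mode_creation.
apply: (subspace_congr iI.1 _ Ie); rewrite -opprB; apply: (subspaceN iI.1).
apply: MI; rewrite /preimage /= (_ : block_proj _ = 0).
  exact: subspace0 iM.1.
by apply: val_inj; rewrite /= modeBr mode_creation cidemM subrr.
Qed.

Lemma block_preimage_inj (M M' : set block_voa) :
  block_proj @^-1` M = block_proj @^-1` M' -> M = M'.
Proof.
move=> MM'; apply/seteqP; split => v Mv.
  have : (block_proj @^-1` M) (val v) by rewrite /preimage /= block_projK.
  by rewrite MM' /preimage /= block_projK.
have : (block_proj @^-1` M') (val v) by rewrite /preimage /= block_projK.
by rewrite -MM' /preimage /= block_projK.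
Qed.

End Block.

(** Maximal ideals of eV pull back injectively to maximal ideals of V containing 1 - e, and by
    hypothesis only M can be such an ideal. *)
Lemma block_local (R : realType) (c : R[i]) (V : voa c)
    (e : central_idempotent V) (M : set V) :
  (forall M', maximal_ideal M' -> M' (vac V - cidem e) -> M' = M) ->
  local (block_voa e).
Proof.
move=> eM.
have eqM (K : set (block_voa e)) : maximal_ideal K -> block_proj e @^-1` K = M.
  move=> mK; apply: eM; first exact: block_maximal_ideal.
  rewrite /preimage /= (_ : block_proj _ _ = 0).
    by have [iK _ _] := mK; exact: subspace0 iK.1.
  by apply: val_inj; rewrite /= modeBr mode_creation cidemM subrr.
have [K mK] := maximal_ideal_ex (block_voa e).
exists K; split => // K' mK'; apply: block_preimage_inj.
by rewrite eqM // eqM.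
Qed.

(** The isomorphism sends v to the family of its components e_i v; its inverse adds the components
    up. *)
Lemma semilocal_blocks (R : realType) (c : R[i]) (V : voa c) n
    (e : 'I_n.+1 -> central_idempotent V) :
  (forall i j, i != j -> mode (e i) (-1) (e j) = 0) ->
  \sum_i cidem (e i) = vac V ->
  (forall i, local (block_voa (e i))) -> semilocal V.
Proof.
move=> eij e1 eloc; exists n, (fun i => block_voa (e i)); split => //.
have sum_act v : \sum_i mode (e i) (-1) v = v.
  by rewrite -mode_suml e1 mode_vacN1.
pose f v : direct_sum (fun i => block_voa (e i)) :=
  [ffun i => block_proj (e i) v : block_voa (e i)].
exists f; split.
- by move=> x u v; apply/ffunP => i; rewrite !(dprodE, ffunE) block_proj_linear.
- pose g (x : dsum_ops (fun i => block_voa (e i))) : V := \sum_i block_val (x i).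
  exists g => [v|x]; rewrite /g.
    by rewrite -[RHS]sum_act; apply: eq_bigr => i _; rewrite ffunE.
  apply/ffunP => i; apply: val_inj; rewrite ffunE /= linear_sum /= (bigD1 i) //=.
  rewrite block_act big1 ?addr0 // => j ji.
  rewrite -(block_act (x j)) -central_assoc ?cidem_central // eij 1?eq_sym //.
  by rewrite mode0l.
- move=> u k v; apply/ffunP => i.
  by rewrite dsum_modeE !ffunE block_proj_mode.
- by apply/ffunP => i; rewrite !ffunE.
- by apply/ffunP => i; rewrite !ffunE.
Qed.

(** * Polynomials in a linear operator and an idempotent modulo a polynomial *)

Section PolyOp.
Variables (K : fieldType) (U : lmodType K) (T : {linear U -> U}).
Implicit Types (p q : {poly K}) (v : U).

Definition poly_op p v : U := \sum_(i < size p) p`_i *: iter i T v.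

Lemma poly_op_widen n p v : (size p <= n)%N ->
  poly_op p v = \sum_(i < n) p`_i *: iter i T v.
Proof.
move=> pn; rewrite /poly_op (big_ord_widen n (fun i => p`_i *: iter i T v)) //.
rewrite big_mkcond; apply: eq_bigr => i _; case: ltnP => // pi.
by rewrite nth_default // scale0r.
Qed.

Lemma poly_opD p q v : poly_op (p + q) v = poly_op p v + poly_op q v.
Proof.
rewrite (poly_op_widen _ (size_polyD p q)).
rewrite (poly_op_widen v (leq_maxl (size p) (size q))).
rewrite (poly_op_widen v (leq_maxr (size p) (size q))) -big_split /=.
by apply: eq_bigr => i _; rewrite coefD scalerDl.
Qed.

Lemma poly_op0 v : poly_op 0 v = 0.
Proof. by rewrite /poly_op size_poly0 big_ord0. Qed.

Lemma poly_opN p v : poly_op (- p) v = - poly_op p v.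
Proof. by apply/eqP; rewrite -subr_eq0 opprK -poly_opD addNr poly_op0. Qed.

Lemma poly_opC x v : poly_op x%:P v = x *: v.
Proof. by rewrite (poly_op_widen v (size_polyC_leq1 x)) big_ord1 coefC. Qed.

Lemma poly_opMX p v : poly_op (p * 'X) v = T (poly_op p v).
Proof.
rewrite (@poly_op_widen (size p).+1); last first.
  by rewrite (leq_trans (size_polyMleq _ _)) // size_polyX addn2.
rewrite big_ord_recl coefMX eqxx scale0r add0r /poly_op linear_sum.
by apply: eq_bigr => i _; rewrite coefMX /= linearZ.
Qed.

Lemma poly_opX v : poly_op 'X v = T v.
Proof. by rewrite -['X]mul1r poly_opMX poly_opC scale1r. Qed.

Lemma poly_opZ x p v : poly_op (x *: p) v = x *: poly_op p v.
Proof.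
rewrite (poly_op_widen v (size_scale_leq x p)) /poly_op scaler_sumr.
by apply: eq_bigr => i _; rewrite coefZ scalerA.
Qed.

Lemma poly_opM p q v : poly_op (p * q) v = poly_op p (poly_op q v).
Proof.
elim/poly_ind: p => [|p x IH]; first by rewrite mul0r !poly_op0.
rewrite mulrDl mul_polyC mulrAC !poly_opD !poly_opMX poly_opC poly_opZ.
by rewrite IH.
Qed.

Lemma poly_op_comm p v (A : {linear U -> U}) :
  (forall u, A (T u) = T (A u)) -> A (poly_op p v) = poly_op p (A v).
Proof.
move=> AT; rewrite /poly_op linear_sum; apply: eq_bigr => i _.
rewrite linearZ /=; congr (_ *: _).
by elim: (i : nat) => //= j IH; rewrite AT IH.
Qed.

Lemma poly_opr0 p : poly_op p 0 = 0.
Proof. by rewrite -{1}(poly_op0 0) -poly_opM mulr0 poly_op0. Qed.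

End PolyOp.

(** Modulo q, the polynomial p is the projector onto the generalized eigenspace for the eigenvalue
    1: it is 1 modulo a power of X - 1 and 0 modulo the complementary factor, by Bezout. *)
Lemma poly_idempotent (K : fieldType) (q : {poly K}) : q != 0 ->
  exists p, [/\ p.[0] = 0, p.[1] = 1 & q %| p * (p - 1)].
Proof.
(* The extra factor X(X - 1) makes 1 a root of q' and, after removal of all factors X - 1, leaves a
   cofactor s with s(0) = 0. *)
move=> q0; pose q' := q * ('X * ('X - 1%:P)).
have q'0 : q' != 0 by rewrite !mulf_neq0 ?polyX_eq0 ?polyXsubC_eq0.
have [m [s]] := multiplicity_XsubC q' 1.
rewrite q'0 /= => s1 q'E.
have m_gt0 : (0 < m)%N.
  case: m q'E => // q'E; case/negP: s1.
  by rewrite -[s]mulr1 -(expr0 ('X - 1%:P)) -q'E /root /q' !hornerM hornerXsubC subrr !mulr0.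
have s0 : s.[0] = 0.
  have /(congr1 (fun p => p.[0])) := q'E.
  rewrite /q' !hornerM hornerX mul0r mulr0 => /esym/eqP.
  rewrite mulf_eq0 => /orP[/eqP //|].
  by rewrite horner_exp hornerXsubC sub0r expf_eq0 oppr_eq0 oner_eq0 andbF.
have : coprimep s (('X - 1%:P) ^+ m) by rewrite coprimep_expr // coprimep_XsubC.
move=> /Bezout_eq1_coprimepP [[u w] /= uw].
exists (u * s); split.
- by rewrite hornerM s0 mulr0.
- have /(congr1 (fun p => p.[1])) := uw; rewrite hornerD hornerM [(w * _).[_]]hornerM.
  by rewrite horner_exp hornerXsubC hornerC subrr expr0n gtn_eqF // mulr0 addr0.
- have -> : u * s * (u * s - 1) = q * ('X * ('X - 1%:P) * (- u * w)).
    have -> : u * s - 1 = - (w * ('X - 1%:P) ^+ m) by rewrite -uw; ring.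
    rewrite [RHS]mulrA -/q' q'E; ring.
  exact: dvdp_mulr.
Qed.

(** * Lifting idempotents under condition (i) *)

Section SelfCommuting.
Variables (R : realType) (c : R[i]) (V : voa c).
Implicit Types (u v w a b e f : V) (I M : set V) (m n p q r : int).

Local Notation D := (mode (conf V) 0).

Lemma modeC u v :
  (forall i : nat, mode u i%:Z v = 0) -> mode v (-1) u = mode u (-1) v.
Proof.
move=> uv; have [N NP] := skew_symmetry u v (-1).
rewrite (NP N.+1 (leqnSn N)) exprN1 invrN1 opprK scale1r big_ord_recl big1 /=.
  by rewrite scale1r mode_creation addr0.
move=> i _; rewrite (_ : -1 + (bump 0 i)%:Z = i%:Z); last by rewrite /bump /=; lia.
by rewrite uv mode0l scaler0.
Qed.

(** Applying D to f(i)f = 0 gives f(i)(Df) = 0 for i >= 0, so f and Df commute and Df = 2f(Df).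
    Multiplying by f yields f(Df) = 2f(Df), hence f(Df) = 0 and Df = 0. *)
Lemma self_commuting_idempotent_central f :
  (forall i : nat, mode f i%:Z f = 0) -> mode f (-1) f = f -> D f = 0.
Proof.
move=> fi ff.
have fD (i : nat) : mode f i%:Z (D f) = 0.
  have := D_mode f i%:Z f; rewrite fi mode0r mode_D.
  case: i => [|i]; first by rewrite oppr0 scale0r add0r.
  by rewrite (_ : i.+1%:Z - 1 = i%:Z) ?fi ?scaler0 ?add0r //; lia.
have Df : D f = mode f (-1) (D f) + mode f (-1) (D f).
  by rewrite -[in LHS]ff D_mode (modeC fD).
have fDf : mode f (-1) (D f) = mode f (-1) (D f) + mode f (-1) (D f).
  by rewrite {1}Df modeDr -(mode_assoc fD fD) ff.
have fDf0 : mode f (-1) (D f) = 0.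
  by apply: (addrI (mode f (-1) (D f))); rewrite addr0 -fDf.
by rewrite Df fDf0 addr0.
Qed.

Lemma weight0_idempotent e :
  (forall n : int, n < -1 -> weight_space V n = [set 0]) ->
  weight_space V 0 e ->
  exists f, [/\ D f = 0, mode f (-1) f = f &
    forall I, is_ideal I -> I (mode e (-1) e - e) -> I (f - e)].
Proof.
move=> Vn e0.
(* The weight of e(i+1)e is -i-2, which is below -1. *)
have ei (i : nat) : mode e i.+1%:Z e = 0.
  have := weight_mode i.+1%:Z e0 e0.
  by rewrite Vn //; lia.
(* For e(0)e, of weight -1, the hypothesis says nothing; skew symmetry gives e(0)e = -e(0)e, its
   other terms being zero by the previous step. *)
have {}ei (i : nat) : mode e i%:Z e = 0.
  case: i => [|i]; last exact: ei.
  have [N NP] := skew_symmetry e e 0.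
  have := NP N.+1 (leqnSn N).
  rewrite big_ord_recl big1 /= => [|i _]; last first.
    by rewrite (_ : 0 + (bump 0 i)%:Z = i.+1%:Z) // ei mode0l scaler0.
  rewrite expr0z scale1r mode_creation addr0 scaleN1r => /eqP.
  rewrite -subr_eq0 opprK -mulr2n -scaler_nat scaler_eq0 pnatr_eq0 /=.
  by move=> /eqP.
pose T : {linear V -> V} := mode e (-1).
have T0 i : weight_space V 0 (iter i T (vac V)).
  elim: i => [|i IH]; first exact: weight_vac.
  exact: (weight_mode (-1) e0 IH).
have [s sP] := voa_findim (voaP V) 0.
(* The vectors T^i applied to the vacuum stay in V_0, so one more of them than V_0 has generators
   are dependent. The relation is encoded by the nonzero polynomial q. *)
have [a [[j aj] aT]] := span_dependent
  (fun i : 'I_(size s).+1 => sP _ (T0 i)) (leqnn _).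
pose q := \poly_(i < (size s).+1) a (inord i).
have q0 : q != 0.
  apply: contraNneq aj => /(congr1 (fun g : {poly R[i]} => g`_j)).
  by rewrite coef_poly ltn_ord inord_val coef0 => ->.
have qT : poly_op T q (vac V) = 0.
  rewrite (poly_op_widen _ _ (size_poly _ _)) -[RHS]aT; apply: eq_bigr => i _.
  by rewrite coef_poly ltn_ord inord_val.
have [p [p0 p1 /dvdpP [r qp]]] := poly_idempotent q0.
pose f := poly_op T p (vac V).
(* A mode commuting with T passes through p(T). This is used first for the modes e(i) and then, once
   e(i)f = 0 is known, for the modes of f itself. *)
have Top u n : (forall v, mode u n (T v) = T (mode u n v)) ->
    mode u n f = poly_op T p (mode u n (vac V)).
  exact: (@poly_op_comm _ _ T p (vac V) (mode u n)).
have ef (i : nat) : mode e i%:Z f = 0.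
  rewrite Top; last by move=> u; apply: mode_comm.
  by rewrite mode_annihilation poly_opr0.
have fT n u : mode f n (T u) = T (mode f n u) by rewrite /T /= (mode_comm _ _ _ ef).
have ff : mode f (-1) f = f.
  rewrite Top // mode_creation -poly_opM.
  have -> : p * p = p + p * (p - 1) by ring.
  by rewrite poly_opD qp poly_opM qT poly_opr0 addr0.
have fi (i : nat) : mode f i%:Z f = 0.
  by rewrite Top // mode_annihilation poly_opr0.
exists f; split => //; first exact: self_commuting_idempotent_central.
move=> I iI Iee.
(* Since p - X vanishes at 0 and 1, it is a multiple of X^2 - X; evaluated at T on the vacuum, this
   puts f - e in every ideal containing ee - e. *)
have [g pg] : exists g, p - 'X = g * ('X * 'X - 'X).
  have /factor_theorem [h ph] : root (p - 'X) 0 by rewrite /root !hornerE p0 subrr.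
  have /factor_theorem [g hg] : root h 1.
    have := congr1 (fun g : {poly R[i]} => g.[1]) ph; rewrite !hornerE p1 subrr subr0 mulr1.
    by rewrite /root => <-.
  by exists g; rewrite ph hg; ring.
have -> : f - e = poly_op T g (mode e (-1) e - e).
  have -> : mode e (-1) e - e = poly_op T ('X * 'X - 'X) (vac V).
    by rewrite poly_opD poly_opN poly_opM !poly_opX /T /= mode_creation.
  by rewrite -poly_opM -pg poly_opD poly_opN poly_opX /T /= mode_creation.
apply: (subspace_sum iI.1) => i; apply: (subspaceZ iI.1).
by elim: (i : nat) => //= j' IH; apply: iI.2.
Qed.

End SelfCommuting.

(** * Lifting idempotents under condition (ii) *)

Section Newton.
Variables (R : realType) (c : R[i]) (V : voa c).
Implicit Types (u v w a b e f : V) (I M : set V) (m n p q r : int).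

Local Notation D := (mode (conf V) 0).

Lemma ideal_pow2_mode I a n b : I a -> I b -> ideal_pow I 2 (mode a n b).
Proof. by move=> Ia Ib; apply: Defs.sub_span; exists a, n, b. Qed.

Lemma ideal_pow2_sub I : is_ideal I -> ideal_pow I 2 `<=` I.
Proof.
move=> iI; apply: span_sub; first exact: iI.1.
by move=> w [a [n [b [_ Ib ->]]]]; apply: iI.2.
Qed.

(** By the commutator formula u(m)a(n)b is a(n)(u(m)b) plus terms in which some u(i)a acts on b, all
    products of two elements of I. *)
Lemma ideal_pow2 I : is_ideal I -> is_ideal (ideal_pow I 2).
Proof.
move=> iI; have sQ := subspace_span (states I 1); split => // u m.
pose B := [set x | ideal_pow I 2 (mode u m x)].
apply: (@span_sub _ _ _ B).
  split; rewrite /B /=; first by rewrite mode0r; apply: subspace0 sQ.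
  by move=> x v w uv uw; rewrite modeDr modeZr; apply: sQ.2.
move=> w [a [n [b [Ia Ib ->]]]]; rewrite /B /=.
have [N /(_ N (leqnn N))/eqP] := commutator u a b m n.
rewrite subr_eq => /eqP ->; apply: (subspaceD sQ).
  apply: (subspace_sum sQ) => i; apply: (subspaceZ sQ).
  by apply: ideal_pow2_mode => //; apply: iI.2.
by apply: ideal_pow2_mode => //; apply: iI.2.
Qed.

(* One Newton step for the equation [x^2 = x]: the new element is
   [e + (1 - 2e)(e^2 - e) = 3e^2 - 2e^3]. *)
Lemma lift_central_idempotent I e :
  is_ideal I -> I (D e) -> I (mode e (-1) e - e) ->
  exists f, [/\ I (f - e), ideal_pow I 2 (D f) &
                ideal_pow I 2 (mode f (-1) f - f)].
Proof.
move=> iI Ix; set x := D e in Ix; set i := mode e (-1) e - e => Ii.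
set Q := ideal_pow I 2; have iQ : is_ideal Q := ideal_pow2 iI.
have sQ := iQ.1.
pose eqm u v := Q (u - v).
have eqm_refl u : eqm u u by rewrite /eqm subrr; apply: subspace0 sQ.
have eqm_sym u v : eqm u v -> eqm v u.
  by rewrite /eqm => /(subspaceN sQ); rewrite opprB.
have eqm_trans v u w : eqm u v -> eqm v w -> eqm u w.
  by rewrite /eqm => uv /(subspaceD sQ uv); rewrite addrA subrK.
have eqmD u u' v v' : eqm u u' -> eqm v v' -> eqm (u + v) (u' + v').
  by rewrite /eqm opprD addrACA; exact: subspaceD.
have eqmN u v : eqm u v -> eqm (- u) (- v).
  by rewrite /eqm -opprD; exact: subspaceN.
have eqmM w n u v : eqm u v -> eqm (mode w n u) (mode w n v).
  by rewrite /eqm -modeBr; apply: iQ.2.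
(* As De is in I, the product (De)(n+1)a = -(n+1)e(n)a lies in I^2. So on I, modulo I^2, e behaves
   like a central element. *)
have en a n : I a -> n != -1 -> Q (mode e n a).
  move=> Ia n1; have := ideal_pow2_mode (n + 1) Ix Ia; rewrite /x mode_D addrK.
  move=> /(subspaceZ sQ (- (n + 1)%:~R)^-1); rewrite scalerA mulVf ?scale1r //.
  by rewrite oppr_eq0 intr_eq0 addr_eq0.
(* [T] is multiplication by e and [S] is multiplication by 1 - 2e. *)
pose T a := mode e (-1) a; pose S a := a - (T a + T a).
have SI a : I a -> I (S a).
  by move=> Ia; apply: (subspaceB iI.1) => //; apply: (subspaceD iI.1); apply: iI.2.
have eqmS u v : eqm u v -> eqm (S u) (S v).
  by move=> uv; apply: (eqmD) => //; apply: (eqmN); apply: (eqmD); apply: (eqmM).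
have Tr a : I a -> eqm (mode a (-1) e) (T a).
  move=> Ia; have [N NP] := skew_symmetry e a (-1).
  rewrite /eqm (NP N.+1 (leqnSn N)) exprN1 invrN1 opprK scale1r big_ord_recl.
  rewrite scale1r mode_creation addrAC subrr add0r.
  apply: (subspace_sum sQ) => j; apply: (subspaceZ sQ).
  by apply: (ideal_descend _ iQ); apply: (en) => //; rewrite /= /bump; lia.
have TT a : I a -> eqm (T (T a)) (T a).
  move=> Ia; apply: (eqm_trans (mode (mode e (-1) e) (-1) a)).
    apply: eqm_sym; have [N NP] := associatorN1 e e a (-1).
    rewrite (NP N.+1 (leqnSn N)) big_ord_recl -[X in eqm _ X]addr0.
    apply: (eqmD); rewrite /eqm ?subr0.
      by rewrite addrAC subrr add0r; apply: iQ.2; apply: (en).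
    apply: (subspace_sum sQ) => j; apply: (subspaceD sQ); apply: iQ.2; apply: (en) => //.
  by rewrite /eqm -modeBl; apply: ideal_pow2_mode.
have TS a : I a -> eqm (T (S a)) (- T a).
  move=> Ia; rewrite /T /S modeBr modeDr -!/(T _).
  apply: (eqm_trans (T a - (T a + T a))).
    by apply: (eqmD) => //; apply: (eqmN); apply: (eqmD); apply: (TT).
  by rewrite opprD addrA subrr add0r.
(* Here (1 - 2e)^2 = 1 + 4(ee - e), which acts on I as the identity modulo I^2. *)
have SS a : I a -> eqm (S (S a)) a.
  move=> Ia; apply: (eqm_trans (S a - (- T a - T a))).
    by apply: (eqmD) => //; apply: (eqmN); apply: (eqmD); apply: (TS).
  by rewrite /S -opprD opprK subrK.
have DT a : I a -> eqm (D (T a)) (T (D a)).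
  by move=> Ia; rewrite /eqm /T D_mode addrK; apply: ideal_pow2_mode.
(* D(ee - e) = (De)e + e(De) - De, which is (2e - 1)x modulo I^2. *)
have Di : eqm (D i) (- S x).
  rewrite /i modeBr D_mode -/x /S opprB.
  by apply: (eqmD) => //; apply: (eqmD) => //; apply: Tr.
have DS : eqm (D (S i)) (- x).
  apply: (eqm_trans (S (D i))).
    rewrite /S modeBr modeDr; apply: (eqmD) => //; apply: (eqmN).
    by apply: (eqmD); apply: (DT).
  apply: (eqm_trans (S (- S x))); first exact: eqmS.
  have -> : S (- S x) = - S (S x) by rewrite {1 3}/S /T modeNr -!opprD.
  by apply: (eqmN); apply: SS.
exists (e + S i); split; first by rewrite addrAC subrr add0r; apply: SI.
  by rewrite -[D _]subr0 modeDr -/x -(subrr x); apply: (eqmD).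
have := SI _ Ii; have := SS _ Ii; move: (S i) => b Sb Ib.
(* With b = S i, the first bracket is in I^2 because S S i = i there, the second because b commutes
   with e modulo I^2, and the last as a product in I. *)
have -> : mode (e + b) (-1) (e + b) - (e + b) =
    (i - S b) + (mode b (-1) e - T b) + mode b (-1) b.
  rewrite modeDl !modeDr -!/(T _) /S opprB opprD.
  by rewrite /i [RHS](AC (2*3*2*1) ((1*3)*(6*8)*(2*5)*(4*7))) /= subrr addr0.
apply: (subspaceD sQ); last exact: ideal_pow2_mode.
apply: (subspaceD sQ); last exact: Tr.
exact: eqm_sym.
Qed.

Lemma lift_central_idempotent_solvable I e :
  is_ideal I -> solvable I -> I (D e) -> I (mode e (-1) e - e) ->
  exists f, [/\ I (f - e), D f = 0 & mode f (-1) f = f].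
Proof.
move=> iI [k Ik] Ix Ii; pose J k := iter k (fun K => ideal_pow K 2) I.
suff [iJ JI [f [If Jx Ji]]] : [/\ is_ideal (J k), J k `<=` I & exists f,
    [/\ I (f - e), J k (D f) & J k (mode f (-1) f - f)]].
  rewrite /J Ik /= in Jx Ji; exists f; split => //.
  exact: subr0_eq.
(* Each Newton correction lies in the current term of the sequence, which is inside I, so the class
   modulo I never changes. *)
elim: k {Ik} => [|k [iJ JI [f [If Jx Ji]]]].
  by split => //; exists e; split => //; rewrite subrr; apply: subspace0 iI.1.
split; first exact: ideal_pow2.
  by apply: subset_trans JI; apply: ideal_pow2_sub.
have [g [Jg Jgx Jgi]] := lift_central_idempotent iJ Jx Ji.
exists g; split => //; rewrite -(subrK f g) -addrA.
by apply: (subspaceD iI.1) => //; apply: JI.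
Qed.

End Newton.

(** * From lifted idempotents to the decomposition of V *)

Section Semilocal.
Variables (R : realType) (c : R[i]) (V : voa c).

Local Notation D := (mode (conf V) 0).

Lemma semilocal_lift :
  (forall e, weight_space V 0 e -> jacobson V (D e) ->
    jacobson V (mode e (-1) e - e) ->
    exists f, [/\ jacobson V (f - e), D f = 0 & mode f (-1) f = f]) ->
  semilocal V.
Proof.
move=> lift; have [k [M [mM Minj Mall]]] := maximal_ideals_enum V.
have [M0 /Mall [i0 _]] := maximal_ideal_ex V.
(* A maximal ideal exists, so k is a successor, as the index type in [semilocal] requires. *)
case: k => [|k] in M mM Minj Mall i0 *; first by case: i0.
have iM i : is_ideal (M i) by case: (mM i).
have JM v : (forall i, M i v) -> jacobson V v by move=> Mv M' /Mall [i ->].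
have [e [e0 eM]] := maximal_ideal_crt0 mM Minj.
have /choice[f fP] i : exists f, [/\ D f = 0, mode f (-1) f = f &
    forall j, M j (f - (i == j)%:R *: vac V)].
  have MDe j : M j (D (e i)).
    have := (iM j).2 (conf V) 0 _ (eM i j).
    by rewrite modeBr modeZr D_vac scaler0 subr0.
  have Mee j : M j (mode (e i) (-1) (e i) - e i).
    have := eM i j; case: (i == j); rewrite ?scale1r ?scale0r ?subr0 => Mij.
      rewrite -[X in _ - X](mode_creation (e i)) -modeBr.
      exact: (iM j).2.
    by apply: (subspaceB (iM j).1) => //; apply: (iM j).2.
  have [f [Jf Df ff]] := lift _ (e0 i) (JM _ MDe) (JM _ Mee).
  exists f; split => // j; rewrite -(subrK (e i) f) -addrA.
  by apply: (subspaceD (iM j).1) => //; apply: Jf.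
have Df i : D (f i) = 0 by case: (fP i).
have ff i : mode (f i) (-1) (f i) = f i by case: (fP i).
have fM i j : M j (f i - (i == j)%:R *: vac V) by case: (fP i).
have f0 i : f i <> 0.
  move=> fi0; apply: (maximal_ideal_vac (mM i)).
  have := fM i i; rewrite fi0 eqxx scale1r sub0r => /(subspaceN (iM i).1).
  by rewrite opprK.
have Mf i j : i != j -> M j (f i).
  by move=> /negPf ij; have := fM i j; rewrite ij scale0r subr0.
(* The product is a central idempotent; every M_l contains f_i or f_j, so it lies in J(V) and
   vanishes. *)
have fij i j : i != j -> mode (f i) (-1) (f j) = 0.
  move=> ij; apply: central_idempotent_jacobson.
  - exact: central_mul.
  - by rewrite central_assoc // [X in mode _ _ X]central_comm // ff
      -central_assoc // ff.
  - apply: JM => l; have [il|il] := eqVneq i l; last first.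
      by apply: ideal_right => //; apply: Mf.
    by apply: (iM l).2; apply: Mf; rewrite -il eq_sym.
(* The defect g = 1 - sum of the f_i is killed by every f_i, hence idempotent, and it lies in every
   M_j; so it is 0 as well. *)
have f1 : \sum_i f i = vac V.
  apply/esym/subr0_eq; set g := _ - _.
  have fg i : mode (f i) (-1) g = 0.
    rewrite /g modeBr mode_creation linear_sum (bigD1 i) //= ff big1 ?addr0 ?subrr //.
    by move=> j ji; rewrite fij // eq_sym.
  apply: central_idempotent_jacobson.
  - rewrite modeBr D_vac linear_sum big1 ?subrr // => i _; exact: Df.
  - by rewrite {1}/g modeBl mode_vacN1 mode_suml big1 ?subr0.
  - apply: JM => j; rewrite /g (bigD1 j) //= opprD addrA.
    apply: (subspaceB (iM j).1).
      rewrite -opprB; apply: (subspaceN (iM j).1).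
      by have := fM j j; rewrite eqxx scale1r.
    by apply: (subspace_sum_cond (iM j).1) => i; exact: Mf.
apply: (@semilocal_blocks _ _ _ _
  (fun i => CentralIdempotent (Df i) (ff i) (@f0 i))) => //= i.
(* For j <> i the ideal M_j contains f_i, so it cannot also contain 1 - f_i. *)
apply: (@block_local _ _ _ _ (M i)) => M' /Mall [j ->] /= Mj.
have [<-//|ij] := eqVneq i j; case: (maximal_ideal_vac (mM j)).
by rewrite -(subrK (f i) (vac V)); apply: (subspaceD (iM j).1) => //; apply: Mf.
Qed.

End Semilocal.

Theorem theorem1 (R : realType) (c : R[i]) (V : voa c) :
  (forall n : int, n < -1 -> weight_space V n = [set 0]) \/
  jacobson V = solvable_radical V ->
  semilocal V.
Proof.
have iJ := ideal_jacobson V.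
move=> H; apply: semilocal_lift => e e0 JDe Jee; case: H => [Vn|JB].
  have [f [Df ff fI]] := weight0_idempotent Vn e0.
  by exists f; split => //; exact: (fI _ iJ Jee).
apply: (lift_central_idempotent_solvable iJ) => //.
(* J(V) contains 0, so by the equality B(V) is not the default [set0] but a genuine solvable ideal;
   hence J(V) is solvable. *)
move: (subspace0 iJ.1); rewrite JB /solvable_radical.
by case: xgetP => [B _ [[_ sB _] _]|].
Qed.
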